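(* Let $\mathcal{H}_S$ be a finite-dimensional complex Hilbert space and let the density matrix $\rho(t)$ on $\mathcal{H}_S$ evolve, for $t\ge 0$, according to the Markovian master equation $$\dot\rho(t) = -i[\hat H_{\rm eff},\rho(t)] + L_D[\rho(t)],\qquad L_D[\rho]=\frac12\sum_{l=1}^M\lambda_l\left([\hat J_l,\rho\hat J_l^\dagger]+[\hat J_l\rho,\hat J_l^\dagger]\right).$$ Let $\hat\Gamma=\sum_{l=1}^M\lambda_l\hat J_l^\dagger\hat J_l$. Let $|\psi_1\rangle,\dots,|\psi_K\rangle$ ($K\ge 1$) be linearly independent vectors of $\mathcal{H}_S$ and let $E_{\rm Jump}=\mathrm{span}\{|\psi_1\rangle,\dots,|\psi_K\rangle\}$. Then $E_{\rm Jump}$ is a restricted decoherence-free subspace for all time $t$ if and only if $E_{\rm Jump}$ is invariant under $\hat H_{\rm eff}$ (i.e. $\hat H_{\rm eff}E_{\rm Jump}\subseteq E_{\rm Jump}$) and there exist complex numbers $c_1,\dots,c_M$ such that, with $g=\sum_{l=1}^M\lambda_l|c_l|^2$, $$\hat J_l|\psi_k\rangle=c_l|\psi_k\rangle,\qquad \hat\Gamma|\psi_k\rangle=g|\psi_k\rangle$$ for all $l=1,\dots,M$ and all $k=1,\dots,K$.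
   Context: Setting: $\mathcal{H}_S$ is a finite-dimensional complex Hilbert space of dimension $N_S$; $\hat H_{\rm eff}$ is a time-independent Hermitian operator on $\mathcal{H}_S$; $\lambda_1,\dots,\lambda_M>0$ are time-independent real numbers; $\hat J_1,\dots,\hat J_M$ (Lindblad or jump operators) are time-independent linear operators on $\mathcal{H}_S$ such that the identity together with $\hat J_1,\dots,\hat J_M$ is linearly independent (so $M\le N_S^2-1$). $[\cdot,\cdot]$ is the commutator. A state evolving by the master equation is a pure restricted decoherence-free state if $\rho^2(t)=\rho(t)$ and $L_D[\rho(t)]=0$ for all $t\ge0$. A subspace $E\subseteq\mathcal{H}_S$ is a restricted decoherence-free subspace for all time if for every unit vector $|\psi\rangle\in E$, the solution $\rho(t)$ of the master equation with $\rho(0)=|\psi\rangle\langle\psi|$ satisfies, for all $t\ge0$: $\rho(t)=|\psi(t)\rangle\langle\psi(t)|$ for some unit vector $|\psi(t)\rangle\in E$, and $L_D[\rho(t)]=0$. *)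

(* Defs.v *)
From HB Require Import structures.
From mathcomp Require Import all_boot all_order all_algebra.
From mathcomp Require Import complex.
From mathcomp Require Import all_classical all_reals all_analysis.

Set Implicit Arguments.
Unset Strict Implicit.
Unset Printing Implicit Defensive.

Import Order.TTheory GRing.Theory Num.Theory.
Import numFieldNormedType.Exports.

Local Open Scope classical_set_scope.
Local Open Scope ring_scope.
Local Open Scope complex_scope.
Local Open Scope sesquilinear_scope.

(* C is R[i] for a realType R; the Hilbert space of dimension n is C^n with its
   standard inner product (antilinear in the first argument):
   kets are column vectors, operators act by left multiplication, and the
   adjoint of A is its conjugate transpose [A ^t*]. *)

Definition braket (R : realType) (n : nat) (u v : 'cV[R[i]]_n) : R[i] :=
  (u ^t* *m v) 0 0.

Definition unit_vector (R : realType) (n : nat) (u : 'cV[R[i]]_n) : Prop :=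
  braket u u = 1.

Definition ketbra (R : realType) (n : nat) (u : 'cV[R[i]]_n) : 'M[R[i]]_n :=
  u *m u ^t*.

Definition commutator (R : realType) (n : nat) (A B : 'M[R[i]]_n) :
  'M[R[i]]_n := A *m B - B *m A.

Definition dissipator (R : realType) (n M : nat)
    (lambda : 'I_M -> R) (J : 'I_M -> 'M[R[i]]_n) (rho : 'M[R[i]]_n) :
    'M[R[i]]_n :=
  2^-1 *: \sum_(l < M) (lambda l)%:C *:
    (commutator (J l) (rho *m (J l) ^t*) + commutator (J l *m rho) ((J l) ^t*)).

Definition master_rhs (R : realType) (n M : nat) (H : 'M[R[i]]_n)
    (lambda : 'I_M -> R) (J : 'I_M -> 'M[R[i]]_n) (rho : 'M[R[i]]_n) :
    'M[R[i]]_n :=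
  (- 'i) *: commutator H rho + dissipator lambda J rho.

Definition Gamma_op (R : realType) (n M : nat)
    (lambda : 'I_M -> R) (J : 'I_M -> 'M[R[i]]_n) : 'M[R[i]]_n :=
  \sum_(l < M) (lambda l)%:C *: ((J l) ^t* *m J l).

(* Derivative at t of a function on [0, +oo[: two-sided for t > 0 and
   right-sided at t = 0, since s ranges over s >= 0 with s != t. *)
Definition has_derivative_ge0 (R : realType) (f : R -> R) (t l : R) : Prop :=
  ((f s - f t) / (s - t) @[s --> within [set s | 0 <= s] t^'] --> l).

Definition has_mx_derivative_ge0 (R : realType) (n : nat)
    (F : R -> 'M[R[i]]_n) (t : R) (A : 'M[R[i]]_n) : Prop :=
  forall i j : 'I_n,
    has_derivative_ge0 (fun s => complex.Re (F s i j)) t (complex.Re (A i j)) /\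
    has_derivative_ge0 (fun s => complex.Im (F s i j)) t (complex.Im (A i j)).

(* The values of rho at negative times are unconstrained. *)
Definition master_solution (R : realType) (n M : nat) (H : 'M[R[i]]_n)
    (lambda : 'I_M -> R) (J : 'I_M -> 'M[R[i]]_n) (rho : R -> 'M[R[i]]_n) :
    Prop :=
  forall t : R, 0 <= t ->
    has_mx_derivative_ge0 rho t (master_rhs H lambda J (rho t)).

(* The master equation is a linear ODE with constant coefficients, so the
   solution rho quantified over exists and is unique on [0, +oo[. *)
Definition restricted_df_subspace (R : realType) (n M : nat)
    (H : 'M[R[i]]_n) (lambda : 'I_M -> R) (J : 'I_M -> 'M[R[i]]_n)
    (E : {vspace 'cV[R[i]]_n}) : Prop :=
  forall psi : 'cV[R[i]]_n, psi \in E -> unit_vector psi ->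
  forall rho : R -> 'M[R[i]]_n,
    master_solution H lambda J rho -> rho 0 = ketbra psi ->
    forall t : R, 0 <= t ->
      (exists psit : 'cV[R[i]]_n,
         [/\ psit \in E, unit_vector psit & rho t = ketbra psit]) /\
      dissipator lambda J (rho t) = 0.

(* Main.v *)
(* Necessity is read off at time 0. For a unit vector u of E, compressing
   L_D[|u><u|] = 0 to the orthogonal complement of u and taking the trace gives
   a vanishing sum of squared norms, so u is an eigenvector of every J_l; since
   this holds on all of E, the eigenvalue c_l does not depend on u, and
   L_D[|u><u|] = 0 then forces Gamma u = g u. Moreover rho(t) u stays in E, so
   its derivative at 0 lies in E, and it equals -i H u up to a multiple of u.

   For sufficiency, the Schroedinger equation u' = -i H u can be solved inside
   the invariant subspace E; there L_D[|u><u|] = 0, so |u(t)><u(t)| solves the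
   master equation, and uniqueness identifies it with rho(t).

   Both directions need linear differential systems with constant coefficients:
   existence comes from the power series \sum_k A^k v t^k / k!, uniqueness from
   Gronwall's inequality for the sum of the squares. *)

Require Import Defs.
From HB Require Import structures.
From mathcomp Require Import all_boot all_order all_algebra.
From mathcomp Require Import complex ring lra.
From mathcomp Require Import all_classical all_reals all_analysis.

Set Implicit Arguments.
Unset Strict Implicit.
Unset Printing Implicit Defensive.

Import Order.TTheory GRing.Theory Num.Theory.
Import numFieldNormedType.Exports.

Local Open Scope classical_set_scope.
Local Open Scope ring_scope.
Local Open Scope complex_scope.
Local Open Scope sesquilinear_scope.

(** * Calculus of real derivatives on the half-line, one-sided at 0 *)

Section RealDerivative.
Variable R : realType.
Implicit Types (f g : R -> R) (t l m : R).

Local Notation F t := (within [set s : R | 0 <= s] t^').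

(** The filter in epsilon-delta form; at [t = 0] only points to the right of 0 count. *)
Lemma near_dnbhs_ge0P t (P : R -> Prop) :
  (\forall s \near F t, P s) <->
  exists2 d : R, 0 < d &
    forall s, 0 <= s -> s != t -> `|s - t| < d -> P s.
Proof.
split=> [/nbhs_ballP[d /= d0 h]|[d d0 h]].
  by exists d => // s s0 st sd; apply: h; rewrite //= /ball /= distrC.
apply/nbhs_ballP; exists d => //= s; rewrite /ball /= distrC => sd st s0.
exact: h.
Qed.

Lemma near_dnbhs_neq t (P : R -> Prop) :
  (forall s, 0 <= s -> s != t -> P s) -> \forall s \near F t, P s.
Proof. by move=> h; apply/near_dnbhs_ge0P; exists 1 => // s s0 st _; apply: h. Qed.

Lemma cvg_dnbhs_ge0_eq f g t l :
  (forall s, 0 <= s -> s != t -> f s = g s) ->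
  f s @[s --> F t] --> l -> g s @[s --> F t] --> l.
Proof. by move=> fg; apply: cvg_trans; apply/near_eq_cvg/near_dnbhs_neq => s s0 /fg ->. Qed.

Lemma has_derivative_ge0_eq f g t l : 0 <= t ->
  (forall s, 0 <= s -> f s = g s) ->
  has_derivative_ge0 f t l -> has_derivative_ge0 g t l.
Proof. by move=> t0 fg; apply: cvg_dnbhs_ge0_eq => s s0 _; rewrite !fg. Qed.

Lemma has_derivative_ge0_cst (c : R) t : has_derivative_ge0 (fun=> c) t 0.
Proof.
rewrite /has_derivative_ge0; under eq_fun do rewrite subrr mul0r.
exact: cvg_cst.
Qed.

(** For [s != t], [f s] is the difference quotient times [s - t], plus [f t], and the product tends
    to [l * 0]. *)
Lemma has_derivative_ge0_cvg f t l : has_derivative_ge0 f t l ->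
  f s @[s --> F t] --> f t.
Proof.
move=> h.
have hs : s - t @[s --> F t] --> (0 : R).
  apply/cvgrPdist_lt => e e0; apply/near_dnbhs_ge0P; exists e => // s _ _.
  by rewrite sub0r normrN.
have := cvgD (cvgM h hs) (cvg_cst (f t)).
rewrite mulr0 add0r => k; apply: (cvg_dnbhs_ge0_eq _ (k _ _ _)) => s s0 st.
by rewrite [LHS]/= divfK ?subrK // subr_eq0.
Qed.

Lemma has_derivative_ge0D f g t l m : has_derivative_ge0 f t l ->
  has_derivative_ge0 g t m -> has_derivative_ge0 (fun s => f s + g s) t (l + m).
Proof.
move=> hf hg; rewrite /has_derivative_ge0.
under eq_fun do rewrite opprD addrACA mulrDl.
exact: cvgD.
Qed.

Lemma has_derivative_ge0M f g t l m : has_derivative_ge0 f t l ->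
  has_derivative_ge0 g t m ->
  has_derivative_ge0 (fun s => f s * g s) t (l * g t + f t * m).
Proof.
move=> hf hg.
have hgt := has_derivative_ge0_cvg hg.
have := cvgD (cvgM hf hgt) (cvgM (cvg_cst (f t)) hg).
by move=> k; apply: (cvg_dnbhs_ge0_eq _ (k _ _ _ _)) => s _ _ /=; ring.
Qed.

Lemma has_derivative_ge0N f t l : has_derivative_ge0 f t l ->
  has_derivative_ge0 (fun s => - f s) t (- l).
Proof.
move=> hf; have := has_derivative_ge0M (has_derivative_ge0_cst (-1) t) hf.
by under eq_fun do rewrite mulN1r; rewrite mul0r add0r mulN1r.
Qed.

Lemma has_derivative_ge0_sum (I : finType) (f : I -> R -> R) (l : I -> R) t :
  (forall i, has_derivative_ge0 (f i) t (l i)) ->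
  has_derivative_ge0 (fun s => \sum_i f i s) t (\sum_i l i).
Proof.
move=> h; elim: (index_enum I) => [|i r IHr].
  rewrite big_nil; under eq_fun do rewrite big_nil.
  exact: has_derivative_ge0_cst.
rewrite big_cons; under eq_fun do rewrite big_cons.
exact: has_derivative_ge0D.
Qed.

Lemma has_derivative_ge0P f t l : has_derivative_ge0 f t l <->
  forall e, 0 < e -> exists2 d : R, 0 < d &
    forall s, 0 <= s -> s != t -> `|s - t| < d ->
      `|l - (f s - f t) / (s - t)| < e.
Proof.
split=> [/cvgrPdist_lt h e e0|h]; first exact/near_dnbhs_ge0P/h.
by apply/cvgrPdist_lt => e e0; apply/near_dnbhs_ge0P; exact: h.
Qed.

(** The point [t + d / 2] lies in every punctured [d]-neighbourhood within the half-line, even for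
    [t = 0]. Uniqueness of the derivative rests on this. *)
Lemma within_ge0_proper t : 0 <= t -> ProperFilter (F t).
Proof.
move=> t0; split; last exact: within_filter.
move=> /near_dnbhs_ge0P[d d0 /(_ (t + d / 2))]; apply.
- by rewrite addr_ge0 // divr_ge0 // ltW.
- by rewrite -subr_eq0 addrAC subrr add0r mulf_neq0 ?gt_eqF ?invr_gt0.
- by rewrite addrAC subrr add0r gtr0_norm ?divr_gt0 // ltr_pdivrMr // ltr_pMr // ltr1n.
Qed.

Lemma has_derivative_ge0_unique f t l m : 0 <= t ->
  has_derivative_ge0 f t l -> has_derivative_ge0 f t m -> l = m.
Proof.
move=> t0 hl hm; have FF := within_ge0_proper t0.
exact: (cvg_unique _ hl hm).
Qed.

Lemma is_derive_has_derivative_ge0 f t l :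
  is_derive t 1 f l -> has_derivative_ge0 f t l.
Proof.
move=> [dft dfl].
have : h^-1 *: (f (h *: 1 + t) - f t) @[h --> 0^'] --> l by rewrite -dfl; exact: dft.
move=> /cvgrPdist_lt h; apply/has_derivative_ge0P => e /h /nbhs_ballP[d /= d0 {}h].
exists d => // s s0 st sd.
have := h (s - t); rewrite /ball /= sub0r normrN => /(_ sd).
by rewrite subr_eq0 [_%:A]mulr1 subrK => /(_ st); rewrite [_ *: _]mulrC.
Qed.

Lemma has_derivative_ge0_is_derive f t l :
  0 < t -> has_derivative_ge0 f t l -> is_derive t 1 f l.
Proof.
move=> t0 /has_derivative_ge0P h.
have hl : h^-1 *: (f (h *: 1 + t) - f t) @[h --> 0^'] --> l.
  apply/cvgrPdist_lt => e /h[d d0 {}h]; apply/nbhs_ballP.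
  (* Increments smaller than [t] keep [x + t] in the half-line, so the limit becomes two-sided. *)
  exists (Num.min d t) => /=; first by rewrite lt_min d0.
  move=> x; rewrite /ball /= sub0r normrN lt_min => /andP[xd xt] x0.
  have := h (x + t); rewrite addrK [_%:A]mulr1 [_ *: _]mulrC; apply => //.
    by move: xt; rewrite ltr_norml => /andP[]; lra.
  by rewrite -subr_eq0 addrK.
by split; [exact: (cvgP l)|exact: cvg_lim].
Qed.

Lemma has_derivative_ge0_cvg_right f l :
  has_derivative_ge0 f 0 l -> f s @[s --> 0^'+] --> f 0.
Proof.
move=> /has_derivative_ge0_cvg; apply: cvg_trans => P /near_dnbhs_ge0P[d d0 h].
suff : \forall s \near (0 : R)^'+, P (f s) by [].
near=> s; apply: (h s).
- by near: s; exact: nbhs_right_ge.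
- by rewrite gt_eqF //; near: s; exact: nbhs_right_gt.
- rewrite subr0 gtr0_norm; first by near: s; exact: nbhs_right_lt.
  by near: s; exact: nbhs_right_gt.
Unshelve. all: by end_near.
Qed.

(** The sign of the derivative is used on the open half-line; right continuity at 0 extends
    monotonicity to the endpoint. *)
Lemma has_derivative_ge0_nincr f f' t : 0 <= t ->
  (forall s, 0 <= s -> has_derivative_ge0 f s (f' s)) ->
  (forall s, 0 <= s -> f' s <= 0) -> f t <= f 0.
Proof.
move=> t0 df f'0.
have df1 (s : R) : 0 < s -> is_derive s 1 f (f' s).
  by move=> s0; apply: has_derivative_ge0_is_derive => //; apply/df/ltW.
apply: (@ler0_derive1_nincry _ f 0) => // [s|s|].
- by rewrite in_itv /= andbT => /df1 [].
- rewrite in_itv /= andbT => s0; rewrite derive1E.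
  by have [_ ->] := df1 _ s0; apply/f'0/ltW.
- apply/continuous_within_itvcyP; split.
    move=> s; rewrite in_itv /= andbT => /df1[+ _].
    by move=> /derivable1_diffP/differentiable_continuous.
  exact: has_derivative_ge0_cvg_right (df _ (lexx _)).
Qed.

End RealDerivative.

(** * Real linear systems with constant coefficients *)

Section RealLinearODE.
Variables (R : realType) (I : finType) (B : I -> I -> R).

Lemma linear_ode_unique_real (f : I -> R -> R) :
  (forall s, 0 <= s -> forall i,
     has_derivative_ge0 (f i) s (\sum_j B i j * f j s)) ->
  (forall i, f i 0 = 0) -> forall t, 0 <= t -> forall i, f i t = 0.
Proof.
move=> df f0 t t0 i.
pose u s := \sum_i f i s * f i s.
(* The Gronwall constant: each square contributes a factor 2 when differentiated, and every product
   [f j s * f k s] is at most [u s] in absolute value, so [u' <= C u]. *)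
pose C := \sum_i \sum_j 2 * `|B i j|.
have sqr_le_u s j : f j s * f j s <= u s.
  by rewrite /u (bigD1 j) //= lerDl sumr_ge0 // => k _; rewrite -expr2 sqr_ge0.
have mul_le_u s j k : `|f j s * f k s| <= u s.
  have := sqr_le_u s j; have := sqr_le_u s k.
  have := sqr_ge0 (f j s - f k s); have := sqr_ge0 (f j s + f k s).
  by rewrite ler_norml; nra.
have dw s : 0 <= s -> has_derivative_ge0 (fun s => u s * expR (- C * s)) s
    ((\sum_i ((\sum_j B i j * f j s) * f i s + f i s * (\sum_j B i j * f j s)))
      * expR (- C * s) + u s * (expR (- C * s) * - C)).
  move=> s0; apply: has_derivative_ge0M.
    by apply: has_derivative_ge0_sum => k; apply: has_derivative_ge0M; exact: df.
  apply: is_derive_has_derivative_ge0.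
  apply: (is_derive1_comp (f := expR) (g := fun s => - C * s)).
  by apply: is_derive_eq; rewrite [LHS]mulr1.
(* The function [u s * expR (- C * s)] vanishes at 0 and does not increase once [u' <= C u] is
   shown; hence [u t <= 0], which kills each square. *)
have := has_derivative_ge0_nincr t0 dw.
rewrite [X in _ -> _ <= X](_ : _ = 0); last first.
  by rewrite /u big1 ?mul0r // => k _; rewrite f0 mul0r.
rewrite pmulr_lle0 ?expR_gt0 // => u_le0.
apply/eqP; rewrite -sqrf_eq0 expr2 eq_le -expr2 sqr_ge0 andbT expr2.
apply: le_trans (sqr_le_u t i) (u_le0 _) => s s0.
rewrite [X in _ + X]mulrCA [X in X + _]mulrC -mulrDr pmulr_rle0 ?expR_gt0 // mulrN subr_le0.
rewrite mulrC /C mulr_suml; apply: ler_sum => k _.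
rewrite [X in _ + X]mulrC -mulr2n !mulr_suml -sumrMnl.
apply: ler_sum => j _.
rewrite -[leLHS]mulr_natl -!mulrA ler_pM2l // (le_trans (ler_norm _)) // normrM.
by rewrite ler_wpM2l.
Qed.

(** Comparison with [V] times the exponential series at [C * |K|]. *)
Lemma is_cvg_pseries_exp_bound (e : R ^nat) (V C K : R) :
  0 <= V -> 0 <= C ->
  (forall k, `|e k| <= V * C ^+ k / k`!%:R) -> cvgn (pseries e K).
Proof.
move=> V0 C0 he; apply: normed_cvg.
apply: (@series_le_cvg _ _ (fun k => V * exp_coeff (C * `|K|) k)) => [k|k|k|] //=.
- by rewrite mulr_ge0 // exp_coeff_ge0 // mulr_ge0.
- rewrite normrM normrX /exp_coeff /= exprMn mulrAC !mulrA.
  by rewrite ler_wpM2r ?exprn_ge0.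
- exact: is_cvg_seriesZ (is_cvg_series_exp_coeff _).
Qed.

Lemma linear_ode_exists_real (v : I -> R) :
  exists f : I -> R -> R, (forall i, f i 0 = v i) /\
    forall s i, has_derivative_ge0 (f i) s (\sum_j B i j * f j s).
Proof.
(* [a k] is the vector B^k v; its entries are bounded by V C^k because [C] dominates the absolute
   sum of every row of [B]. *)
pose a k : I -> R := iter k (fun w i => \sum_j B i j * w j) v.
pose V := \sum_i `|v i|; pose C := \sum_i \sum_j `|B i j|.
have V0 : 0 <= V by apply: sumr_ge0.
have C0 : 0 <= C by apply: sumr_ge0 => i _; apply: sumr_ge0.
have a_le k i : `|a k i| <= V * C ^+ k.
  elim: k i => [|k IHk] i.
    by rewrite expr0 mulr1 /= /V (bigD1 i) //= lerDl sumr_ge0.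
  rewrite /a iterS -/(a k) (le_trans (ler_norm_sum _ _ _)) //.
  rewrite exprS mulrCA; apply: (@le_trans _ _ ((\sum_j `|B i j|) * (V * C ^+ k))).
    by rewrite mulr_suml; apply: ler_sum => j _; rewrite normrM ler_wpM2l.
  rewrite ler_wpM2r ?mulr_ge0 ?exprn_ge0 // /C [leRHS](bigD1 i) //= lerDl.
  by apply: sumr_ge0 => j _; apply: sumr_ge0.
(* [c m i] holds the coefficients of component [i] of exp(xB) B^m v, the m-th derivative of the
   solution; termwise differentiation turns [m] into [m.+1]. *)
pose c m i k := a (k + m)%N i / k`!%:R.
have cvg_c m i x : cvgn (pseries (c m i) x).
  apply: (@is_cvg_pseries_exp_bound _ (V * C ^+ m) C) => //.
    by rewrite mulr_ge0 // exprn_ge0.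
  move=> k; rewrite normrM [`|_^-1|]ger0_norm ?invr_ge0 //.
  by rewrite ler_wpM2r ?invr_ge0 // -mulrA -exprD addnC.
have diffs m i : pseries_diffs (c m i) = c m.+1 i.
  apply/funext => k; rewrite /pseries_diffs /c addSnnS factS natrM invfM.
  by rewrite mulrCA mulVKf.
exists (fun i x => limn (pseries (c 0%N i) x)); split => [i|s i].
  (* At 0 only the term of index 0 survives, so the partial sums equal [v i] from [n = 1] on. *)
  apply: lim_near_cst => //; near=> n.
  have n0 : (0 < n)%N by near: n; exact: nbhs_infty_gt.
  rewrite /pseries /series /= -(prednK n0) big_nat_recl // big1 => [|k _].
    by rewrite /c expr0 mulr1 divr1 addr0.
  by rewrite exprS mul0r mulr0.
have -> : \sum_j B i j * limn (pseries (c 0%N j) s) =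
    limn (pseries (pseries_diffs (c 0%N i)) s).
  apply/esym/cvg_lim => //.
  (* Already at the level of partial sums, the differentiated series is [B] applied to the original
     ones. *)
  have -> : pseries (pseries_diffs (c 0%N i)) s =
      (fun n => \sum_j B i j * pseries (c 0%N j) s n).
    apply/funext => n; rewrite diffs /pseries /series /=.
    under [RHS]eq_bigr do rewrite mulr_sumr.
    rewrite exchange_big /=; apply: eq_bigr => k _.
    rewrite /c addn1 addn0 /a iterS -/(a k) !mulr_suml.
    by apply: eq_bigr => j _; rewrite !mulrA.
  apply: (@cvg_big _ _ +%R) => // [|j _]; first exact: add_continuous.
  by apply: cvgM; [exact: cvg_cst|exact: cvg_c].
apply/is_derive_has_derivative_ge0.
(* Any radius beyond [|s|] would do, since the series converge everywhere. *)
apply: (@pseries_snd_diffs _ _ (`|s| + 1)); rewrite ?diffs //.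
by rewrite [ltRHS]ger0_norm ?addr_ge0 // ltrDl.
Unshelve. all: by end_near.
Qed.

End RealLinearODE.

(** * Derivatives of complex-valued functions of a real variable *)

Section ComplexDerivative.
Variable R : realType.
Implicit Types (f g : R -> R[i]) (z w : R[i]) (t : R).

(** Convertible to the entrywise clause of [has_mx_derivative_ge0], so the two are exchanged without
    rewriting. *)
Definition has_cderivative_ge0 f t z : Prop :=
  has_derivative_ge0 (fun s => complex.Re (f s)) t (complex.Re z) /\
  has_derivative_ge0 (fun s => complex.Im (f s)) t (complex.Im z).

Lemma ReD z w : complex.Re (z + w) = complex.Re z + complex.Re w.
Proof. by case: z w => [a b] [c d]. Qed.

Lemma ImD z w : complex.Im (z + w) = complex.Im z + complex.Im w.
Proof. by case: z w => [a b] [c d]. Qed.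

Lemma ReM z w :
  complex.Re (z * w) = complex.Re z * complex.Re w - complex.Im z * complex.Im w.
Proof. by case: z w => [a b] [c d]. Qed.

Lemma ImM z w :
  complex.Im (z * w) = complex.Re z * complex.Im w + complex.Im z * complex.Re w.
Proof. by case: z w => [a b] [c d]. Qed.

Lemma has_cderivative_ge0_cst z t : has_cderivative_ge0 (fun=> z) t 0.
Proof. by split; exact: has_derivative_ge0_cst. Qed.

Lemma has_cderivative_ge0D f g t z w : has_cderivative_ge0 f t z ->
  has_cderivative_ge0 g t w -> has_cderivative_ge0 (fun s => f s + g s) t (z + w).
Proof.
move=> [fR fI] [gR gI]; split.
  by under eq_fun do rewrite ReD; rewrite ReD; exact: has_derivative_ge0D.
by under eq_fun do rewrite ImD; rewrite ImD; exact: has_derivative_ge0D.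
Qed.

Lemma has_cderivative_ge0_sum (I : finType) (f : I -> R -> R[i])
    (z : I -> R[i]) t :
  (forall i, has_cderivative_ge0 (f i) t (z i)) ->
  has_cderivative_ge0 (fun s => \sum_i f i s) t (\sum_i z i).
Proof.
move=> h; elim: (index_enum I) => [|i r IHr].
  rewrite big_nil; under eq_fun do rewrite big_nil.
  exact: has_cderivative_ge0_cst.
rewrite big_cons; under eq_fun do rewrite big_cons.
exact: has_cderivative_ge0D.
Qed.

Lemma has_cderivative_ge0M f g t z w : has_cderivative_ge0 f t z ->
  has_cderivative_ge0 g t w ->
  has_cderivative_ge0 (fun s => f s * g s) t (z * g t + f t * w).
Proof.
move=> [fR fI] [gR gI]; split.
  under eq_fun do rewrite ReM.
  rewrite ReD !ReM addrACA -opprD.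
  by apply: has_derivative_ge0D; [|apply: has_derivative_ge0N]; exact: has_derivative_ge0M.
under eq_fun do rewrite ImM.
have := has_derivative_ge0D (has_derivative_ge0M fR gI) (has_derivative_ge0M fI gR).
by rewrite ImD !ImM; congr (has_derivative_ge0 _ _ _); ring.
Qed.

Lemma has_cderivative_ge0B f g t z w : has_cderivative_ge0 f t z ->
  has_cderivative_ge0 g t w -> has_cderivative_ge0 (fun s => f s - g s) t (z - w).
Proof.
move=> df dg; have := has_cderivative_ge0M (has_cderivative_ge0_cst (-1) t) dg.
under eq_fun do rewrite mulN1r; rewrite mul0r add0r mulN1r => dNg.
exact: has_cderivative_ge0D.
Qed.

Lemma has_cderivative_ge0_conj f t z : has_cderivative_ge0 f t z ->
  has_cderivative_ge0 (fun s => Num.conj (f s)) t (Num.conj z).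
Proof.
have conjE w : (complex.Re (Num.conj w) = complex.Re w) *
    (complex.Im (Num.conj w) = - complex.Im w) by case: w.
move=> [fR fI]; split.
  by under eq_fun do rewrite conjE; rewrite conjE.
under eq_fun do rewrite conjE.
by rewrite conjE; exact: has_derivative_ge0N.
Qed.

Lemma has_cderivative_ge0_eq f g t z : 0 <= t ->
  (forall s, 0 <= s -> f s = g s) ->
  has_cderivative_ge0 f t z -> has_cderivative_ge0 g t z.
Proof.
by move=> t0 fg [fR fI]; split; [move: fR|move: fI];
  apply: has_derivative_ge0_eq => // s s0; rewrite fg.
Qed.

Lemma has_cderivative_ge0_unique f t z w : 0 <= t ->
  has_cderivative_ge0 f t z -> has_cderivative_ge0 f t w -> z = w.
Proof.
move=> t0 [zR zI] [wR wI]; apply/eqP; rewrite eq_complex; apply/andP; split.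
  exact/eqP/(has_derivative_ge0_unique t0 zR wR).
exact/eqP/(has_derivative_ge0_unique t0 zI wI).
Qed.

End ComplexDerivative.

(** * Complex linear systems, reduced to real ones of twice the size *)

Section ComplexLinearODE.
Variables (R : realType) (I : finType) (A : I -> I -> R[i]).

Definition Re_or_Im (b : bool) (z : R[i]) : R :=
  if b then complex.Im z else complex.Re z.

(* The matrix of [A] as a real-linear map, the component [(i, b)] being the
   real ([b = false]) or imaginary part of the component [i]. *)
Definition realify (p q : I * bool) : R :=
  let z := A p.1 q.1 in
  if p.2 == q.2 then complex.Re z else (-1) ^+ q.2 * complex.Im z.

Lemma realifyE (z : I -> R[i]) i b :
  Re_or_Im b (\sum_j A i j * z j) =
  \sum_p realify (i, b) p * Re_or_Im p.2 (z p.1).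
Proof.
have -> : Re_or_Im b (\sum_j A i j * z j) = \sum_j Re_or_Im b (A i j * z j).
  case: b; rewrite /Re_or_Im.
    by apply: (big_morph _ (@ImD R)).
  by apply: (big_morph _ (@ReD R)).
rewrite -(pair_bigA _ (fun j b' => realify (i, b) (j, b') * Re_or_Im b' (z j))) /=.
apply: eq_bigr => j _; rewrite big_bool /realify /Re_or_Im /=.
case: b => /=; first by rewrite ImM expr0 mul1r.
by rewrite ReM expr1 mulN1r mulNr addrC.
Qed.

Lemma linear_ode_unique (f : I -> R -> R[i]) :
  (forall s, 0 <= s -> forall i,
     has_cderivative_ge0 (f i) s (\sum_j A i j * f j s)) ->
  (forall i, f i 0 = 0) -> forall t, 0 <= t -> forall i, f i t = 0.
Proof.
move=> df f0 t t0 i.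
have h b : Re_or_Im b (f i t) = 0.
  apply: (@linear_ode_unique_real _ _ realify
    (fun p s => Re_or_Im p.2 (f p.1 s)) _ _ t t0 (i, b)) => [s s0 [j c]|[j c]] /=.
    by rewrite -(realifyE (f^~ s)); case: c; have [] := df s s0 j.
  by rewrite f0; case: c.
by move: (h false) (h true); rewrite /Re_or_Im; case: (f i t) => x y /= -> ->.
Qed.

Lemma linear_ode_exists (v : I -> R[i]) :
  exists f : I -> R -> R[i], (forall i, f i 0 = v i) /\
    forall s i, has_cderivative_ge0 (f i) s (\sum_j A i j * f j s).
Proof.
have [g [g0 dg]] := linear_ode_exists_real realify (fun p => Re_or_Im p.2 (v p.1)).
exists (fun i s => Complex (g (i, false) s) (g (i, true) s)); split => [i|s i].
  by rewrite !g0; case: (v i).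
have e b : Re_or_Im b (\sum_j A i j * Complex (g (j, false) s) (g (j, true) s)) =
    \sum_p realify (i, b) p * g p s.
  by rewrite realifyE; apply: eq_bigr => -[j []].
split=> /=; [have := e false|have := e true]; rewrite /Re_or_Im => ->; exact: dg.
Qed.

End ComplexLinearODE.

(** * Linear differential equations for matrices *)

Section MatrixLinearODE.
Variable R : realType.

(** Expansion on matrix units: it turns a linear map on matrices into a coefficient array indexed by
    pairs, to which the results on scalar systems apply. *)
Lemma linear_mxE n m p (L : {linear 'M[R[i]]_n -> 'M[R[i]]_(m, p)}) X i j :
  L X i j = \sum_q L (delta_mx q.1 q.2) i j * X q.1 q.2.
Proof.
rewrite {1}(matrix_sum_delta X) pair_bigA linear_sum summxE.
by apply: eq_bigr => q _; rewrite linearZ mxE mulrC.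
Qed.

Lemma has_mx_derivative_ge0_linear n m p
    (L : {linear 'M[R[i]]_n -> 'M[R[i]]_(m, p)}) F t A :
  has_mx_derivative_ge0 F t A ->
  forall i j, has_cderivative_ge0 (fun s => L (F s) i j) t (L A i j).
Proof.
move=> dF i j; rewrite linear_mxE; under eq_fun do rewrite linear_mxE.
apply: has_cderivative_ge0_sum => q.
have := has_cderivative_ge0M
  (has_cderivative_ge0_cst (L (delta_mx q.1 q.2) i j) t) (dF q.1 q.2).
by rewrite mul0r add0r.
Qed.

Variables (n : nat) (L : {linear 'M[R[i]]_n -> 'M[R[i]]_n}).

Lemma linear_mx_ode_exists X0 : exists2 X : R -> 'M[R[i]]_n, X 0 = X0 &
  forall t, 0 <= t -> has_mx_derivative_ge0 X t (L (X t)).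
Proof.
have [f [f0 df]] := linear_ode_exists
  (fun p q : 'I_n * 'I_n => L (delta_mx q.1 q.2) p.1 p.2) (fun p => X0 p.1 p.2).
exists (fun t => \matrix_(i, j) f (i, j) t).
  by apply/matrixP => i j; rewrite mxE f0.
move=> t _ i j; set X := fun t => \matrix_(i, j) f (i, j) t.
suff : has_cderivative_ge0 (fun s => X s i j) t (L (X t) i j) by [].
have -> : L (X t) i j = \sum_q L (delta_mx q.1 q.2) i j * f q t.
  by rewrite linear_mxE; apply: eq_bigr => q _; rewrite mxE -surjective_pairing.
have <- : f (i, j) = fun s => X s i j by apply/funext => s; rewrite mxE.
exact: df t (i, j).
Qed.

Lemma linear_mx_ode_unique (X Y : R -> 'M[R[i]]_n) :
  (forall t, 0 <= t -> has_mx_derivative_ge0 X t (L (X t))) ->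
  (forall t, 0 <= t -> has_mx_derivative_ge0 Y t (L (Y t))) ->
  X 0 = Y 0 -> forall t, 0 <= t -> X t = Y t.
Proof.
move=> dX dY XY0 t t0; apply/matrixP => i j; apply/eqP; rewrite -subr_eq0; apply/eqP.
apply: (@linear_ode_unique _ _
  (fun p q : 'I_n * 'I_n => L (delta_mx q.1 q.2) p.1 p.2)
  (fun p s => X s p.1 p.2 - Y s p.1 p.2) _ _ t t0 (i, j)) => [s s0 p|p].
  under eq_bigr do rewrite mulrBr.
  rewrite sumrB -!linear_mxE; apply: has_cderivative_ge0B; first exact: dX.
  exact: dY.
by rewrite XY0 subrr.
Qed.

End MatrixLinearODE.

(** * Adjoints, brackets and rank-one projectors *)

Section Adjoint.
Variable R : realType.

Lemma adjmxM m n p (A : 'M[R[i]]_(m, n)) (B : 'M[R[i]]_(n, p)) :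
  (A *m B)^t* = B^t* *m A^t*.
Proof. by rewrite trmx_mul map_mxM. Qed.

Lemma adjmxK m n (A : 'M[R[i]]_(m, n)) : (A^t*)^t* = A.
Proof. by apply/matrixP => i j; rewrite !mxE conjCK. Qed.

Lemma adjmxZ m n (a : R[i]) (A : 'M[R[i]]_(m, n)) :
  (a *: A)^t* = Num.conj a *: A^t*.
Proof. by apply/matrixP => i j; rewrite !mxE rmorphM. Qed.

Lemma conj_real (x : R) : Num.conj (x%:C) = x%:C.
Proof. exact: conjc_real. Qed.

Lemma hermsymmx_adj n (A : 'M[R[i]]_n) : A \is hermsymmx -> A^t* = A.
Proof. by move=> /is_hermitianmxP; rewrite expr0 scale1r => <-. Qed.

Variable n : nat.
Implicit Types u v : 'cV[R[i]]_n.

Lemma adj_mul_braket u v : u^t* *m v = (braket u v)%:M.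
Proof. exact: mx11_scalar. Qed.

Lemma ketbra_mul u v : ketbra u *m v = braket u v *: u.
Proof. by rewrite /ketbra -mulmxA adj_mul_braket mul_mx_scalar. Qed.

Lemma ketbra_adj u : (ketbra u)^t* = ketbra u.
Proof. by rewrite /ketbra adjmxM adjmxK. Qed.

Lemma braketE u : braket u u = \sum_i `|u i 0| ^+ 2.
Proof. by rewrite /braket mxE; apply: eq_bigr => i _; rewrite !mxE mulrC -normCK. Qed.

Lemma braketZ a u : braket (a *: u) (a *: u) = `|a| ^+ 2 * braket u u.
Proof.
rewrite !braketE mulr_sumr; apply: eq_bigr => i _.
by rewrite mxE normrM exprMn.
Qed.

Lemma braket_ge0 u : 0 <= braket u u.
Proof. by rewrite braketE sumr_ge0 // => i _; rewrite exprn_ge0. Qed.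

Lemma braket_eq0 u : braket u u = 0 -> u = 0.
Proof.
rewrite braketE => /eqP; rewrite psumr_eq0 => [/allP h|i _]; last by rewrite exprn_ge0.
apply/matrixP => i j; rewrite ord1 mxE; apply/eqP.
by have := h i; rewrite mem_index_enum sqrf_eq0 normr_eq0; apply.
Qed.

Lemma mxtrace_ketbra u : \tr (ketbra u) = braket u u.
Proof. by rewrite /ketbra mxtrace_mulC adj_mul_braket mxtrace_scalar. Qed.

(** Normalisation: it carries linear facts known for unit vectors of [E] over to all nonzero
    ones. *)
Lemma unit_vector_scale (E : {vspace 'cV[R[i]]_n}) v : v \in E -> v != 0 ->
  exists a u, [/\ u \in E, unit_vector u & v = a *: u].
Proof.
move=> vE v0; pose a := sqrtC (braket v v).
have a0 : a != 0 by rewrite sqrtC_eq0; apply: contra v0 => /eqP/braket_eq0/eqP.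
exists a, (a^-1 *: v); split; [exact: memvZ| |by rewrite scalerA mulfV ?scale1r].
rewrite /unit_vector braketZ ger0_norm ?invr_ge0 ?sqrtC_ge0 ?braket_ge0 //.
by rewrite exprVn sqrtCK mulVf // -sqrtC_eq0.
Qed.

End Adjoint.

(** * The dissipator and its vanishing on pure states *)

Section Lindblad.
Variables (R : realType) (n M : nat) (H : 'M[R[i]]_n).
Variables (lambda : 'I_M -> R) (J : 'I_M -> 'M[R[i]]_n).
Implicit Types (u v : 'cV[R[i]]_n) (rho : 'M[R[i]]_n) (E : {vspace 'cV[R[i]]_n}).

Local Notation Gamma := (Gamma_op lambda J).

(** The usual Lindblad form: jump terms minus half the anticommutator with [Gamma]. *)
Lemma dissipatorE rho : dissipator lambda J rho =
  \sum_l (lambda l)%:C *: (J l *m rho *m (J l)^t*) -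
  2^-1 *: (Gamma *m rho + rho *m Gamma).
Proof.
rewrite /dissipator /Gamma_op mulmx_suml mulmx_sumr -big_split /= !scaler_sumr.
rewrite -sumrB; apply: eq_bigr => l _.
rewrite /commutator -scalemxAl -scalemxAr !mulmxA.
move: (J l *m rho *m _) (rho *m _ *m _) (_ *m J l *m rho) => X Y Z.
by apply/matrixP => i j; rewrite !mxE; field.
Qed.

Lemma dissipator_is_linear : linear (dissipator lambda J).
Proof.
move=> a X Y; rewrite !dissipatorE scalerBr.
rewrite (_ : \sum_l _ = a *: (\sum_l (lambda l)%:C *: (J l *m X *m (J l)^t*)) +
    \sum_l (lambda l)%:C *: (J l *m Y *m (J l)^t*)); last first.
  rewrite scaler_sumr -big_split; apply: eq_bigr => l _ /=.
  rewrite mulmxDr mulmxDl scalerDr -scalemxAr -scalemxAl.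
  by rewrite scalerA mulrC -scalerA.
have -> : Gamma *m (a *: X + Y) + (a *: X + Y) *m Gamma =
    a *: (Gamma *m X + X *m Gamma) + (Gamma *m Y + Y *m Gamma).
  by rewrite mulmxDr mulmxDl -scalemxAr -scalemxAl addrACA -scalerDr.
by rewrite addrACA [2^-1 *: _]scalerDr opprD !scalerA [a * _]mulrC.
Qed.

Lemma master_rhs_is_linear : linear (master_rhs H lambda J).
Proof.
move=> a X Y; rewrite /master_rhs dissipator_is_linear.
have -> : commutator H (a *: X + Y) = a *: commutator H X + commutator H Y.
  rewrite /commutator mulmxDr mulmxDl -scalemxAr -scalemxAl opprD.
  by rewrite addrACA -scalerBr.
by rewrite [in LHS]scalerDr [in RHS]scalerDr !scalerA ![a * _]mulrC addrACA.
Qed.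

(** Makes the matrix differential equation results applicable to the master equation. *)
HB.instance Definition _ :=
  GRing.isLinear.Build R[i] 'M[R[i]]_n 'M[R[i]]_n *:%R (master_rhs H lambda J)
    master_rhs_is_linear.

Lemma Gamma_op_adj : Gamma^t* = Gamma.
Proof.
rewrite /Gamma_op raddf_sum /= map_mx_sum; apply: eq_bigr => l _.
by rewrite adjmxZ adjmxM adjmxK conj_real.
Qed.

Lemma Gamma_op_braket u : u^t* *m (Gamma *m u) =
  (\sum_l (lambda l)%:C * braket (J l *m u) (J l *m u))%:M.
Proof.
rewrite /Gamma_op mulmx_suml mulmx_sumr raddf_sum; apply: eq_bigr => l _ /=.
by rewrite -scalemxAl -scalemxAr !mulmxA -adjmxM -mulmxA adj_mul_braket scale_scalar_mx.
Qed.

Section JointEigenvector.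
Variables (u : 'cV[R[i]]_n) (c : 'I_M -> R[i]).
Hypothesis Ju : forall l, J l *m u = c l *: u.
Let g := \sum_(l < M) (lambda l)%:C * `|c l| ^+ 2.

Lemma dissipator_ketbra : dissipator lambda J (ketbra u) =
  g *: ketbra u - 2^-1 *: (Gamma *m u *m u^t* + u *m (Gamma *m u)^t*).
Proof.
rewrite dissipatorE adjmxM Gamma_op_adj /ketbra !mulmxA; congr (_ - _).
rewrite /g scaler_suml; apply: eq_bigr => l _.
rewrite mulmxA Ju -[_ *m _ *m (J l)^t*]mulmxA -adjmxM Ju adjmxZ.
by rewrite -scalemxAl -scalemxAr !scalerA -mulrA -normCK.
Qed.

Lemma dissipator_ketbra_eq0 :
  Gamma *m u = g *: u -> dissipator lambda J (ketbra u) = 0.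
Proof.
move=> Gu; rewrite dissipator_ketbra Gu adjmxZ.
(* Since [g] is real, both halves of the anticommutator contribute [g] and cancel the jump terms. *)
have -> : Num.conj g = g.
  rewrite /g rmorph_sum; apply: eq_bigr => l _.
  by rewrite rmorphM /= conj_real geC0_conj // exprn_ge0.
rewrite -scalemxAl -scalemxAr -/(ketbra u) -mulr2n -[g *: _ *+ 2]scaler_nat !scalerA.
by rewrite mulrA mulVf ?pnatr_eq0 // mul1r subrr.
Qed.

(** Applying the vanishing dissipator to [u] gives 2 g u = Gamma u + <u|Gamma u> u, and <u|Gamma u>
    is the sum of [lambda l] times the squared norms of the [J l *m u], that is [g]. *)
Lemma Gamma_eigenvector : unit_vector u ->
  dissipator lambda J (ketbra u) = 0 -> Gamma *m u = g *: u.
Proof.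
move=> u1 /(congr1 (mulmx^~ u)) /=; rewrite mul0mx dissipator_ketbra.
rewrite mulmxBl -!scalemxAl mulmxDl ketbra_mul u1 scale1r -!mulmxA.
rewrite [u^t* *m u]adj_mul_braket u1 mulmx1 adjmxM Gamma_op_adj -mulmxA Gamma_op_braket.
rewrite (_ : \sum_l _ = g); last first.
  by apply: eq_bigr => l _; rewrite Ju braketZ u1 mulr1.
rewrite mul_mx_scalar => /eqP; rewrite subr_eq0 => /eqP h.
have : (2 : R[i]) *: (g *: u) = Gamma *m u + g *: u.
  by rewrite {1}h scalerA mulfV ?pnatr_eq0 // scale1r.
by rewrite scaler_nat mulr2n => /addIr.
Qed.

End JointEigenvector.

(* Conjugating the dissipator by the projector [Q] orthogonal to [u] leaves
   [\sum_l lambda l *: Q J_l u (Q J_l u)^*], whose trace is a sum of squares. *)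
Lemma jump_eigenvector u : (forall l, 0 < lambda l) -> unit_vector u ->
  dissipator lambda J (ketbra u) = 0 ->
  forall l, J l *m u = braket u (J l *m u) *: u.
Proof.
move=> lambda_gt0 u1 D0 l.
pose Q := 1%:M - ketbra u.
have QE v : Q *m v = v - braket u v *: u by rewrite mulmxBl mul1mx ketbra_mul.
have Qu : Q *m u = 0 by rewrite QE u1 scale1r subrr.
have Qadj : Q^t* = Q.
  by rewrite /Q linearB /= map_mxB ketbra_adj trmx1 map_mx1.
have Qk : Q *m ketbra u = 0 by rewrite mulmxA Qu mul0mx.
have kQ : ketbra u *m Q = 0 by rewrite -ketbra_adj -Qadj -adjmxM Qk trmx0 map_mx0.
clearbody Q; pose w l := Q *m (J l *m u).
have /(congr1 (fun X => \tr (Q *m X *m Q))) := D0.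
rewrite mulmx0 mul0mx mxtrace0 dissipatorE mulmxBr mulmxBl.
(* As [Q] annihilates [ketbra u] from either side, both terms with [Gamma] drop out. *)
rewrite -scalemxAr -scalemxAl mulmxDr [Q *m (ketbra u *m _)]mulmxA Qk mul0mx addr0.
rewrite -[Q *m (Gamma *m _) *m Q]mulmxA -[Gamma *m _ *m Q]mulmxA kQ !mulmx0.
rewrite scaler0 subr0 mulmx_sumr mulmx_suml raddf_sum /=.
under eq_bigr => k _.
  rewrite -scalemxAr -scalemxAl linearZ /=.
  rewrite (_ : Q *m _ *m Q = ketbra (w k)); last first.
    by rewrite /w /ketbra !adjmxM Qadj !mulmxA.
  rewrite mxtrace_ketbra.
over.
move=> /eqP; rewrite psumr_eq0 => [/allP h|k _]; last first.
  by rewrite mulr_ge0 ?braket_ge0 // ler0c ltW.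
have := h l; rewrite mem_index_enum mulf_eq0 => /(_ isT).
have -> : ((lambda l)%:C == 0) = false by rewrite gt_eqF // ltcR.
rewrite orFb => /eqP/braket_eq0.
by rewrite /w QE => /eqP; rewrite subr_eq0 => /eqP.
Qed.

End Lindblad.

(** * Decoherence-free subspaces *)

Section DecoherenceFree.
Variables (R : realType) (n M : nat) (H : 'M[R[i]]_n).
Variables (lambda : 'I_M -> R) (J : 'I_M -> 'M[R[i]]_n).
Implicit Types (u v : 'cV[R[i]]_n) (E : {vspace 'cV[R[i]]_n}).

(** If [v0] and [v] are independent eigenvectors and [v0 + v] is one too, comparing coefficients
    makes the three eigenvalues agree. *)
Lemma common_eigenvalue (A : 'M[R[i]]_n) E :
  (forall v, v \in E -> exists c, A *m v = c *: v) ->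
  exists c, forall v, v \in E -> A *m v = c *: v.
Proof.
move=> hA; pose v0 := vpick E; have v0E : v0 \in E := memv_pick E.
have [c Av0] := hA _ v0E; exists c => v vE.
have [/vlineP[k ->]|v_notin] := boolP (v \in <[v0]>%VS).
  by rewrite -scalemxAr Av0 !scalerA mulrC.
have [e Av] := hA _ vE; have [d] := hA _ (memvD v0E vE).
rewrite mulmxDr Av0 Av => /eqP; rewrite -subr_eq0 scalerDr opprD addrACA -!scalerBl.
have [->|de] := eqVneq e d.
  rewrite subrr scale0r addr0 scaler_eq0 subr_eq0 => /orP[/eqP-> //|].
  (* [vpick E] is 0 only when [E] is the zero space, and then [v = 0]. *)
  by rewrite vpick0 => /eqP E0; move: vE; rewrite E0 memv0 => /eqP->; rewrite !scaler0.
rewrite addrC addr_eq0 => /eqP h; case/negP: v_notin; apply/vlineP.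
exists ((e - d)^-1 * - (c - d)).
by rewrite -scalerA scaleNr -h scalerA mulVf ?scale1r // subr_eq0.
Qed.

(** Extends the relations given on the vectors [psi k] to their whole span. *)
Lemma span_eigenvector (A : 'M[R[i]]_n) (a : R[i]) (X : seq 'cV[R[i]]_n) v :
  (forall w, w \in X -> A *m w = a *: w) -> v \in <<X>>%VS -> A *m v = a *: v.
Proof.
move=> AX /(@coord_span _ _ _ (in_tuple X)) ->.
rewrite mulmx_sumr scaler_sumr; apply: eq_bigr => i _.
by rewrite -scalemxAr AX ?mem_nth // !scalerA mulrC.
Qed.

(** [restricted_df_subspace] quantifies over solutions, so information is extracted from it only by
    exhibiting one. *)
Lemma master_solution_exists (rho0 : 'M[R[i]]_n) :
  exists2 rho, rho 0 = rho0 & master_solution H lambda J rho.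
Proof. exact: linear_mx_ode_exists (master_rhs H lambda J) rho0. Qed.

(** * Necessity of the conditions *)

Section Necessity.
Variable E : {vspace 'cV[R[i]]_n}.
Hypothesis dfE : restricted_df_subspace H lambda J E.

Lemma restricted_df_dissipator u :
  u \in E -> unit_vector u -> dissipator lambda J (ketbra u) = 0.
Proof.
move=> uE u1; have [rho rho0 drho] := master_solution_exists (ketbra u).
by have [_] := dfE uE u1 drho rho0 (lexx 0); rewrite rho0.
Qed.

(* [rho t *m u] stays in [E], hence so does its derivative at [0], which is
   [H u] up to a nonzero factor and a multiple of [u]. *)
Lemma restricted_df_invariant v : v \in E -> H *m v \in E.
Proof.
move=> vE; have [->|v0] := eqVneq v 0; first by rewrite mulmx0 mem0v.
have [a [u [uE u1 vu]]] := unit_vector_scale vE v0.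
suff HuE : H *m u \in E by rewrite vu -scalemxAr memvZ.
have [rho rho0 drho] := master_solution_exists (ketbra u).
(* [L X = 0] means that [X *m u] lies in [E]; being linear, [L] commutes with the derivative. *)
pose L := ((\1 - projv E)%VF \o mulmxr u : 'M[R[i]]_n -> 'cV[R[i]]_n).
have LE X : L X = X *m u - projv E (X *m u).
  by rewrite /L /= add_lfunE opp_lfunE id_lfunE.
have L0 t : 0 <= t -> L (rho t) = 0.
  move=> t0; have [[w [wE _ ->]] _] := dfE uE u1 drho rho0 t0.
  by rewrite LE ketbra_mul projv_id ?subrr // memvZ.
have : master_rhs H lambda J (ketbra u) *m u \in E.
  suff : L (master_rhs H lambda J (rho 0)) = 0.
    by rewrite LE rho0 => /eqP; rewrite subr_eq0 => /eqP->; exact: memv_proj.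
  apply/matrixP => i j; rewrite mxE.
  have dL := has_mx_derivative_ge0_linear L (drho 0 (lexx 0)) i j.
  apply: has_cderivative_ge0_unique (lexx 0) dL _.
  apply: (has_cderivative_ge0_eq _ _ (has_cderivative_ge0_cst 0 0)) => // s s0.
  by have /matrixP/(_ i j) := L0 s s0; rewrite [X in _ = X]mxE => /esym.
(* Only the commutator is left, and [H, |u><u|] u = H u - <u|H u> u. *)
rewrite /master_rhs restricted_df_dissipator // addr0 -scalemxAl.
rewrite rpredZeq oppr_eq0 (negbTE (neq0Ci _)) /commutator mulmxBl.
rewrite -[H *m _ *m u]mulmxA -[_ *m H *m u]mulmxA !ketbra_mul u1 scale1r => hE.
by rewrite -[H *m u](subrK (braket u (H *m u) *: u)) memvD // memvZ.
Qed.

(** Once the [c l] are common to all of [E], so is the eigenvalue of [Gamma], which they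
    determine. *)
Lemma restricted_df_eigenvector : (forall l, 0 < lambda l) ->
  exists c : 'I_M -> R[i], forall v, v \in E ->
    (forall l, J l *m v = c l *: v) /\
    Gamma_op lambda J *m v = (\sum_(l < M) (lambda l)%:C * `|c l| ^+ 2) *: v.
Proof.
move=> lambda_gt0.
have /choice[c hc] : forall l, exists c, forall v, v \in E -> J l *m v = c *: v.
  move=> l; apply: common_eigenvalue => v vE.
  have [->|v0] := eqVneq v 0; first by exists 0; rewrite mulmx0 scaler0.
  have [a [u [uE u1 vu]]] := unit_vector_scale vE v0.
  have := jump_eigenvector lambda_gt0 u1 (restricted_df_dissipator uE u1) l.
  move: (braket _ _) => b Ju; exists b.
  by rewrite vu -scalemxAr Ju !scalerA mulrC.
exists c => v vE; split=> [l|]; first exact: hc.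
have [->|v0] := eqVneq v 0; first by rewrite mulmx0 scaler0.
have [a [u [uE u1 vu]]] := unit_vector_scale vE v0.
rewrite vu -scalemxAr (Gamma_eigenvector (fun l => hc l u uE) u1) ?restricted_df_dissipator //.
by rewrite !scalerA mulrC.
Qed.

End Necessity.

(** * Sufficiency: Schroedinger evolution inside an invariant subspace *)

Lemma schrodinger_exists E v : (forall w, w \in E -> H *m w \in E) -> v \in E ->
  exists2 u : R -> 'cV[R[i]]_n, u 0 = v & forall t, u t \in E /\
    forall k, has_cderivative_ge0 (fun s => u s k 0) t ((- 'i *: (H *m u t)) k 0).
Proof.
move=> HE vE; pose b i := (vbasis E)`_i.
have bE (i : 'I_(\dim E)) : b i \in E.
  by apply/vbasis_mem/mem_nth; rewrite size_tuple.
(* The matrix of [H] restricted to [E]: solving for coordinates in a basis of [E] keeps the solution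
   in [E]. *)
pose h (i j : 'I_(\dim E)) := coord (vbasis E) i (H *m b j).
have Hb (j : 'I_(\dim E)) : H *m b j = \sum_(i < \dim E) h i j *: b i.
  exact/coord_vbasis/HE.
have [f [f0 df]] := linear_ode_exists (fun i j => - 'i * h i j)
  (fun i => coord (vbasis E) i v).
exists (fun t => \sum_(i < \dim E) f i t *: b i) => [|t].
  by rewrite [RHS](coord_vbasis vE); apply: eq_bigr => i _; rewrite f0.
split=> [|k]; first by apply: memv_suml => i _; exact: memvZ.
under eq_fun do rewrite summxE.
rewrite (_ : _ k 0 = \sum_(i < \dim E)
    (\sum_j - 'i * h i j * f j t) * b i k 0); last first.
  rewrite mxE mulmx_sumr summxE mulr_sumr.
  under eq_bigr => j _ do rewrite -scalemxAr Hb mxE summxE !mulr_sumr.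
  rewrite exchange_big /=; apply: eq_bigr => i _; rewrite mulr_suml.
  by apply: eq_bigr => j _; rewrite mxE; ring.
apply: has_cderivative_ge0_sum => i; under eq_fun do rewrite mxE.
have := has_cderivative_ge0M (df t i) (has_cderivative_ge0_cst (b i k 0) t).
by rewrite mulr0 addr0.
Qed.

Lemma invariant_restricted_df E (c : 'I_M -> R[i]) : H \is hermsymmx ->
  (forall v, v \in E -> H *m v \in E) ->
  (forall v, v \in E ->
    (forall l, J l *m v = c l *: v) /\
    Gamma_op lambda J *m v = (\sum_(l < M) (lambda l)%:C * `|c l| ^+ 2) *: v) ->
  restricted_df_subspace H lambda J E.
Proof.
move=> /hermsymmx_adj Hadj HE JE v vE v1 rho drho rho0 t t0.
have D0 w : w \in E -> dissipator lambda J (ketbra w) = 0.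
  by move=> /JE[Jw Gw]; apply: dissipator_ketbra_eq0 Jw Gw.
have [u u0 du] := schrodinger_exists HE vE.
have uE s : u s \in E by have [] := du s.
(* With [H] self-adjoint, -i[H, .] takes the shape that the product rule gives for the derivative of
   [ketbra (u s)]. *)
have rhsE s : master_rhs H lambda J (ketbra (u s)) =
    (- 'i *: (H *m u s)) *m (u s)^t* + u s *m (- 'i *: (H *m u s))^t*.
  rewrite /master_rhs D0 // addr0 /commutator /ketbra scalerBr adjmxZ adjmxM Hadj.
  by rewrite -scalemxAl -scalemxAr !mulmxA rmorphN /= conjCi opprK -scaleNr opprK.
have mulE (x y : 'cV[R[i]]_n) k l :
    (x *m y^t*) k l = x k 0 * Num.conj (y l 0) by rewrite mxE big_ord1 !mxE.
have dk : master_solution H lambda J (fun s => ketbra (u s)).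
  move=> s _ i j.
  suff : has_cderivative_ge0 (fun r => ketbra (u r) i j) s
    (master_rhs H lambda J (ketbra (u s)) i j) by [].
  rewrite rhsE mxE !mulE; under eq_fun do rewrite /ketbra mulE.
  exact: has_cderivative_ge0M ((du s).2 i) (has_cderivative_ge0_conj ((du s).2 j)).
have rhoE : rho t = ketbra (u t).
  by apply: linear_mx_ode_unique drho dk _ t t0; rewrite rho0 u0.
rewrite rhoE; split; last exact: D0.
exists (u t); split => //; apply/eqP; rewrite -subr_eq0; apply/eqP.
(* Conservation of the norm: [braket (u s) (u s)] is the trace of [ketbra (u s)], whose derivative
   is the trace of a multiple of a commutator. Uniqueness for the one-component system with
   coefficient 0 makes it constant. *)
apply: (@linear_ode_unique _ unit (fun _ _ => 0)
  (fun _ s => braket (u s) (u s) - 1) _ _ t t0 tt) => [s s0 _|_]; last first.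
  by rewrite u0 v1 subrr.
rewrite big1 => [|k _]; last by rewrite mul0r.
rewrite -[X in has_cderivative_ge0 _ _ X]subr0.
apply: has_cderivative_ge0B (has_cderivative_ge0_cst 1 s).
under eq_fun do rewrite -mxtrace_ketbra.
have <- : \tr (master_rhs H lambda J (ketbra (u s))) = 0.
  rewrite /master_rhs D0 // addr0 linearZ /= /commutator linearB /=.
  by rewrite mxtrace_mulC subrr mulr0.
by apply: has_cderivative_ge0_sum => k; exact: dk.
Qed.

End DecoherenceFree.

Theorem theorem4 (R : realType) (n M K : nat)
  (H : 'M[R[i]]_n) (lambda : 'I_M -> R) (J : 'I_M -> 'M[R[i]]_n)
  (psi : 'I_K -> 'cV[R[i]]_n)
  (hH : H \is hermsymmx)
  (hlambda : forall l : 'I_M, 0 < lambda l)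
  (hJ : free ((1%:M : 'M[R[i]]_n) :: codom J))
  (hK : (1 <= K)%N)
  (hpsi : free (codom psi)) :
  restricted_df_subspace H lambda J <<codom psi>>%VS <->
  ((forall v : 'cV[R[i]]_n,
      v \in <<codom psi>>%VS -> H *m v \in <<codom psi>>%VS) /\
   exists c : 'I_M -> R[i],
     let g := \sum_(l < M) (lambda l)%:C * `|c l| ^+ 2 in
     (forall (l : 'I_M) (k : 'I_K), J l *m psi k = c l *: psi k) /\
     (forall k : 'I_K, Gamma_op lambda J *m psi k = g *: psi k)).
Proof.
split=> [df|[HE [c [Jc Gc]]]].
  split; first exact: restricted_df_invariant df.
  have [c hc] := restricted_df_eigenvector df hlambda.
  have psiE k : psi k \in <<codom psi>>%VS by apply/memv_span/codom_f.
  by exists c; split=> [l k|k]; have [] := hc _ (psiE k).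
apply: (invariant_restricted_df hH HE (c := c)) => v vE.
split=> [l|].
  by apply: span_eigenvector vE => _ /codomP[k ->].
by apply: span_eigenvector vE => _ /codomP[k ->].
Qed.
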